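(* Let $A,B\in \mathbb{C}^{n\times n}$ be group matrices and let $r=\operatorname{rank}(A)$. Then the following are equivalent: (i) $A^{\mathrm{core}}B=0$ (that is, $A$ is left core-orthogonal to $B$); (ii) there exist a unitary matrix $U\in \mathbb{C}^{n\times n}$ and a nonsingular matrix $T\in \mathbb{C}^{r\times r}$ such that $$A=U\begin{bmatrix}T& S\\ 0 & 0\end{bmatrix}U^*,\qquad B=U\begin{bmatrix}0 & 0\\ B_3 & B_4\end{bmatrix}U^*,$$ where $S\in\mathbb{C}^{r\times(n-r)}$, $B_3\in\mathbb{C}^{(n-r)\times r}$, $B_4\in\mathbb{C}^{(n-r)\times(n-r)}$ is a group matrix, and $(I_{n-r}-B_4B_4^{\mathrm{core}})B_3=0$. Further, for any such decomposition, $$B^{\mathrm{core}}=U\begin{bmatrix}0 & 0\\ 0 & B_4^{\mathrm{core}}\end{bmatrix}U^*.$$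
   Context: A square matrix $M$ is a group matrix if it has index at most $1$, i.e. $\operatorname{rank}(M)=\operatorname{rank}(M^2)$. The core inverse $M^{\mathrm{core}}$ of a square matrix $M$ is the unique matrix $X$ (when it exists) with $MX=MM^\dagger$ and $\mathcal{R}(X)\subseteq\mathcal{R}(M)$, where $M^\dagger$ is the Moore-Penrose inverse and $\mathcal{R}$ denotes column space; it exists if and only if $M$ is a group matrix. $M^*$ is the conjugate transpose. Blocks with zero rows or columns are allowed. *)

(* Defs.v *)
From mathcomp Require Export all_boot all_order all_algebra.
From mathcomp Require Export classical_sets reals complex.

Set Implicit Arguments.
Unset Strict Implicit.
Unset Printing Implicit Defensive.

Import GRing.Theory Num.Theory.
Local Open Scope ring_scope.
Local Open Scope sesquilinear_scope.
Local Open Scope classical_set_scope.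

Definition group_mx (C : numClosedFieldType) (n : nat) (M : 'M[C]_n) : Prop :=
  \rank M = \rank (M *m M).

Definition is_mp_inverse (C : numClosedFieldType) (m n : nat)
    (M : 'M[C]_(m, n)) (X : 'M[C]_(n, m)) : Prop :=
  [/\ M *m X *m M = M, X *m M *m X = X,
      (M *m X) ^t* = M *m X & (X *m M) ^t* = X *m M].

(* The set below always has exactly one element, so the default 0 is never
   used. *)
Definition mp_inverse (C : numClosedFieldType) (m n : nat)
    (M : 'M[C]_(m, n)) : 'M[C]_(n, m) :=
  xget 0 [set X | is_mp_inverse M X].

(* (_ <= _)%MS compares row spaces, so column spaces are compared through
   transposes. *)
Definition is_core_inverse (C : numClosedFieldType) (n : nat)
    (M X : 'M[C]_n) : Prop :=
  M *m X = M *m mp_inverse M /\ (X^T <= M^T)%MS.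

(* The set below has exactly one element when M is a group matrix and is empty
   otherwise; the value 0 in the latter case is a junk value. *)
Definition core_inverse (C : numClosedFieldType) (n : nat)
    (M : 'M[C]_n) : 'M[C]_n :=
  xget 0 [set X | is_core_inverse M X].

Definition left_core_orthogonal (C : numClosedFieldType) (n : nat)
    (A B : 'M[C]_n) : Prop :=
  core_inverse A *m B = 0.

(* The sizes r + (n - r) and n are equal but not convertible, hence the cast. *)
Definition rank_block_mx (C : numClosedFieldType) (n : nat) (A : 'M[C]_n)
    (ul : 'M[C]_(\rank A)) (ur : 'M[C]_(\rank A, n - \rank A))
    (dl : 'M[C]_(n - \rank A, \rank A)) (dr : 'M[C]_(n - \rank A)) : 'M[C]_n :=
  let e := subnKC (rank_leq_row A) in castmx (e, e) (block_mx ul ur dl dr).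
Arguments rank_block_mx {C n} A ul ur dl dr.

Definition core_orthogonal_decomposition (C : numClosedFieldType) (n : nat)
    (A B U : 'M[C]_n) (T : 'M[C]_(\rank A))
    (S : 'M[C]_(\rank A, n - \rank A)) (B3 : 'M[C]_(n - \rank A, \rank A))
    (B4 : 'M[C]_(n - \rank A)) : Prop :=
  [/\ U \is unitarymx /\ T \in unitmx,
      A = U *m rank_block_mx A T S 0 0 *m U ^t*,
      B = U *m rank_block_mx A 0 0 B3 B4 *m U ^t*,
      group_mx B4
    & (1%:M - B4 *m core_inverse B4) *m B3 = 0].
Arguments core_orthogonal_decomposition {C n} A B U T S B3 B4.

(* Main.v *)
(* When A is a group matrix, A^core B = 0 just says A^* B = 0, i.e. the ranges
   of A and B are orthogonal.  In an orthonormal basis of C^n that starts with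
   a basis of R(A), this kills the lower rows of A and the upper rows of B.
   Comparing ranks of A and A^2 makes T invertible, and writing B = B^2 Y gives
   R(B_3) <= R(B_4) = R(B_4^2).  The formula for B^core is then read off the
   three properties characterising a core inverse X of M: M X is Hermitian,
   M X M = M and R(X) <= R(M). *)

Require Import Defs.

Set Implicit Arguments.
Unset Strict Implicit.
Unset Printing Implicit Defensive.

Import GRing.Theory Num.Theory.

Local Open Scope ring_scope.
Local Open Scope sesquilinear_scope.

(** * Conjugate transposes and unitary conjugation *)

Lemma adjmx_mul (C : numClosedFieldType) m n p (A : 'M[C]_(m, n))
    (B : 'M[C]_(n, p)) : (A *m B)^t* = B^t* *m A^t*.
Proof. by rewrite trmx_mul map_mxM. Qed.

Lemma adjmx_block (C : numClosedFieldType) m1 m2 n1 n2 (A : 'M[C]_(m1, n1))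
    (B : 'M[C]_(m1, n2)) (D : 'M[C]_(m2, n1)) (E : 'M[C]_(m2, n2)) :
  (block_mx A B D E)^t* = block_mx (A^t*) (D^t*) (B^t*) (E^t*).
Proof. by rewrite tr_block_mx map_block_mx. Qed.

Lemma adjmx0 (C : numClosedFieldType) m n : (0 : 'M[C]_(m, n))^t* = 0.
Proof. by rewrite trmx0 map_mx0. Qed.

Lemma adjmx_unitaryK (C : numClosedFieldType) n (U : 'M[C]_n) :
  U \is unitarymx -> U^t* *m U = 1%:M.
Proof. by move=> /unitarymxP /mulmx1C. Qed.

Lemma adjmx_unitary_conj (C : numClosedFieldType) m n (U : 'M[C]_(m, n))
    (M : 'M[C]_n) : (U *m M *m U^t*)^t* = U *m M^t* *m U^t*.
Proof. by rewrite !adjmx_mul trmxCK mulmxA. Qed.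

Lemma mul_unitary_conj (C : numClosedFieldType) n (U M N : 'M[C]_n) :
  U \is unitarymx ->
  (U *m M *m U^t*) *m (U *m N *m U^t*) = U *m (M *m N) *m U^t*.
Proof.
by move=> /adjmx_unitaryK UU; rewrite !mulmxA -(mulmxA (U *m M)) UU mulmx1.
Qed.

(** * Existence of the Moore-Penrose inverse *)

(** A compact SVD with an invertible, not necessarily diagonal, core: Gram-Schmidt on the rows of
    [M] gives [Q], then on the rows of the adjoint of the left factor gives [P]. For rectangular
    matrices [unitarymx] means orthonormal rows. *)
Lemma unitary_rank_factorization (C : numClosedFieldType) m n
    (M : 'M[C]_(m, n)) :
  exists r (P : 'M_(r, m)) (K : 'M_r) (Q : 'M_(r, n)),
    [/\ P \is unitarymx, Q \is unitarymx, K \in unitmx &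
        M = P^t* *m K *m Q].
Proof.
pose Q := schmidt (row_base M).
have QQ : Q *m Q^t* = 1%:M.
  by apply/unitarymxP/schmidt_unitarymx/rank_leq_col.
have QE : (Q :=: M)%MS.
  apply: eqmx_trans (eq_row_base M).
  exact/eqmx_schmidt_free/row_base_free.
have [L ML] : exists L, M = L *m Q by apply/submxP; rewrite QE.
have Lfree : row_free (L^t*).
  rewrite /row_free mxrank_map mxrank_tr eqn_leq rank_leq_col /=.
  by rewrite {1}ML mxrankM_maxl.
pose P := schmidt (L^t*).
have PP : P *m P^t* = 1%:M.
  by apply/unitarymxP/schmidt_unitarymx/rank_leq_row.
have PE : (P :=: L^t*)%MS by exact: eqmx_schmidt_free.
have /submxP[D LD] : (L^t* <= P)%MS by rewrite PE.
have Dunit : D^t* \in unitmx.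
  rewrite map_unitmx unitmx_tr -row_free_unit /row_free eqn_leq rank_leq_row.
  by have := mxrankM_maxl D P; rewrite -LD (eqP Lfree).
have ME : M = P^t* *m D^t* *m Q.
  by rewrite -adjmx_mul -LD trmxCK.
by exists (\rank M), P, (D^t*), Q; split=> //; exact/unitarymxP.
Qed.

Lemma mp_inverse_exists (C : numClosedFieldType) m n (M : 'M[C]_(m, n)) :
  exists X, is_mp_inverse M X.
Proof.
have [r [P [K [Q [/unitarymxP PP /unitarymxP QQ Kunit ME]]]]] :=
  unitary_rank_factorization M.
(* With this choice [M X] and [X M] become the orthogonal projections [P^t* P] and [Q^t* Q]. *)
pose X := Q^t* *m invmx K *m P.
have MX : M *m X = P^t* *m P.
  by rewrite ME /X !mulmxA -(mulmxA _ Q) QQ mulmx1 mulmxK.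
have XM : X *m M = Q^t* *m Q.
  by rewrite ME /X !mulmxA -(mulmxA _ P) PP mulmx1 mulmxKV.
exists X; split.
- by rewrite MX ME !mulmxA -(mulmxA _ P) PP mulmx1.
- by rewrite XM /X !mulmxA -(mulmxA _ Q) QQ mulmx1.
- by rewrite MX adjmx_mul trmxCK.
- by rewrite XM adjmx_mul trmxCK.
Qed.

Lemma mp_inverseP (C : numClosedFieldType) m n (M : 'M[C]_(m, n)) :
  is_mp_inverse M (mp_inverse M).
Proof.
by have := xgetPex (0 : 'M[C]_(n, m)) (mp_inverse_exists M).
Qed.

(** * Group matrices and the core inverse *)

Lemma trmx_sub_mulP (F : fieldType) m n p (X : 'M[F]_(m, n))
    (M : 'M[F]_(m, p)) :
  (X^T <= M^T)%MS <-> exists Z, X = M *m Z.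
Proof.
split=> [/submxP[D XD]|[Z ->]]; last by rewrite trmx_mul submxMl.
by exists D^T; apply: trmx_inj; rewrite trmx_mul trmxK.
Qed.

(** R(M^2) always lies in R(M), so equal ranks mean equal column spaces. *)
Lemma group_mxP (C : numClosedFieldType) n (M : 'M[C]_n) :
  group_mx M <-> exists Y, M = M *m M *m Y.
Proof.
split=> [rM|[Y MY]].
  apply/trmx_sub_mulP; rewrite trmx_mul.
  have := mxrank_leqif_sup (submxMl M^T M^T).
  by rewrite /= -trmx_mul !mxrank_tr -rM => -[_ <-].
by apply/eqP; rewrite eqn_leq mxrankM_maxl {1}MY mxrankM_maxl.
Qed.

(** Equal ranks also make the row spaces of [M] and [M^2] equal, so [M = W M^2] for some [W]. *)
Lemma group_mx_ker (C : numClosedFieldType) n p (M : 'M[C]_n)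
    (Z : 'M[C]_(n, p)) : group_mx M -> M *m (M *m Z) = 0 -> M *m Z = 0.
Proof.
move=> rM MMZ; have := mxrank_leqif_sup (submxMl M M).
rewrite /= -rM => -[_]; rewrite eqxx => /esym/submxP[W ->].
by rewrite -!mulmxA MMZ mulmx0.
Qed.

Lemma core_inverse_spec (C : numClosedFieldType) n (M : 'M[C]_n) :
  group_mx M -> is_core_inverse M (core_inverse M).
Proof.
move=> gM; have [Y MY] := (group_mxP M).1 gM.
suff coreM : exists X, is_core_inverse M X by have := xgetPex 0 coreM.
(* As [M = M^2 Y], multiplying this witness by [M] gives [M M^+]. *)
exists (M *m Y *m mp_inverse M); split.
  by rewrite !mulmxA -MY.
by apply/trmx_sub_mulP; exists (Y *m mp_inverse M); rewrite mulmxA.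
Qed.

(** [M M^+] is Hermitian and fixes [M]; from here on these properties replace the Moore-Penrose
    inverse. *)
Lemma core_inverseP (C : numClosedFieldType) n (M : 'M[C]_n) :
  group_mx M ->
  [/\ (M *m core_inverse M)^t* = M *m core_inverse M,
      M *m core_inverse M *m M = M
    & exists Z, core_inverse M = M *m Z].
Proof.
move=> /core_inverse_spec[MX /trmx_sub_mulP XM].
by have [MPM _ MP _] := mp_inverseP M; rewrite MX.
Qed.

(* M X and M M^+ are Hermitian with the same range, so they agree; and a
   matrix with columns in R(M) is determined by its product with M. *)
Lemma core_inverse_unique (C : numClosedFieldType) n (M X : 'M[C]_n) :
  group_mx M -> (M *m X)^t* = M *m X -> M *m X *m M = M ->
  (exists Z, X = M *m Z) -> core_inverse M = X.
Proof.
move=> gM hX MXM [Z XZ]; have [hK MKM [W KW]] := core_inverseP gM.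
have MXK : M *m X = M *m core_inverse M.
  rewrite -hX -{1}MKM -(mulmxA _ M) adjmx_mul hX hK mulmxA.
  by rewrite MXM.
apply/eqP; rewrite -subr_eq0 {1}KW XZ -mulmxBr; apply/eqP.
by apply: group_mx_ker => //; rewrite mulmxBr mulmxBr -KW -XZ MXK subrr.
Qed.

(** With [X] the core inverse of [A], [A^t* = A^t* A X] and [X = X A X = X X^t* A^t*], so [X] and
    [A^t*] annihilate the same matrices. *)
Lemma left_core_orthogonalP (C : numClosedFieldType) n (A B : 'M[C]_n) :
  group_mx A -> left_core_orthogonal A B <-> A^t* *m B = 0.
Proof.
move=> gA; have [hX AXA [Z XZ]] := core_inverseP gA.
rewrite /left_core_orthogonal; split=> [XB|AB].
  by rewrite -{1}AXA adjmx_mul hX -!mulmxA XB !mulmx0.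
move: (core_inverse A) hX AXA XZ => X hX AXA XZ.
(* [X - X A X] has its columns in R(A) and is killed by [A], hence vanishes. *)
have XAX : X = X *m A *m X.
  have XE : X - X *m A *m X = A *m (Z - Z *m A *m X).
    by rewrite mulmxBr !mulmxA -XZ.
  apply/eqP; rewrite -subr_eq0 XE; apply/eqP/group_mx_ker => //.
  by rewrite -XE mulmxBr !mulmxA AXA subrr.
by rewrite XAX -(mulmxA X A X) -hX adjmx_mul -!mulmxA AB !mulmx0.
Qed.

(** * Group matrices in block form *)

Lemma mxrank_unitary_conj (C : numClosedFieldType) n (U M : 'M[C]_n) :
  U \is unitarymx -> \rank (U *m M *m U^t*) = \rank M.
Proof.
move=> uU; rewrite mxrankMfree.
  by rewrite eqmxMfull // row_full_unit unitarymx_unit.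
by rewrite row_free_unit unitarymx_unit ?trmxC_unitary.
Qed.

Lemma group_mx_unitary_conj (C : numClosedFieldType) n (U M : 'M[C]_n) :
  U \is unitarymx -> group_mx (U *m M *m U^t*) <-> group_mx M.
Proof.
by move=> uU; rewrite /group_mx mul_unitary_conj // !mxrank_unitary_conj.
Qed.

(** The rows of [Q1] and [Q2] are orthonormal bases of the row space of [V] and of its orthogonal
    complement. *)
Lemma unitary_completion (C : numClosedFieldType) m n r s (V : 'M[C]_(m, n)) :
  \rank V = r -> (n - r)%N = s ->
  exists (Q1 : 'M[C]_(r, n)) (Q2 : 'M[C]_(s, n)),
    col_mx Q1 Q2 \is unitarymx /\ V *m Q2^t* = 0.
Proof.
move=> <-{r}; rewrite -rank_ortho => <-{s}.
exists (schmidt (row_base V)), (schmidt (row_base (orthomx Num.conj 1%:M V))).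
split; first exact: schmidt_complete_unitarymx.
apply/orthomx1P; rewrite orthomx_sym.
by rewrite (eqmx_schmidt_free (row_base_free _)) eq_row_base.
Qed.

Lemma group_block_row0_unit (C : numClosedFieldType) r s
    (T : 'M[C]_r) (S : 'M[C]_(r, s)) :
  group_mx (block_mx T S 0 0 : 'M_(r + s)) ->
  \rank (block_mx T S 0 0 : 'M_(r + s)) = r -> T \in unitmx.
Proof.
rewrite /group_mx => -> rk; rewrite -row_free_unit /row_free eqn_leq.
rewrite rank_leq_row -{1}rk.
(* The square factors through [T], so its rank [r] is at most that of [T]. *)
have -> : block_mx T S 0 0 *m block_mx T S 0 0 =
          col_mx 1%:M 0 *m T *m row_mx T S :> 'M[C]_(r + s).
  rewrite mulmx_block mul_col_mx mul1mx mul0mx mul_col_row.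
  by rewrite !(mul0mx, mulmx0, addr0).
by rewrite (leq_trans (mxrankM_maxl _ _)) ?mxrankM_maxr.
Qed.

Lemma group_block_col0 (C : numClosedFieldType) r s
    (B3 : 'M[C]_(s, r)) (B4 : 'M[C]_s) :
  group_mx (block_mx 0 0 B3 B4 : 'M_(r + s)) ->
  group_mx B4 /\ (1%:M - B4 *m core_inverse B4) *m B3 = 0.
Proof.
move=> /group_mxP[Y]; rewrite -(submxK Y) !mulmx_block.
rewrite !(mul0mx, mulmx0, addr0, add0r) => /eq_block_mx[_ _ B3E B4E].
rewrite -!mulmxA -mulmxDr in B3E.
have gB4 : group_mx B4.
  (* [B3] is [B4] times a matrix; substituting this into [B4E] turns it into [B4 = B4 B4 (...)]. *)
  apply/group_mxP; rewrite B3E in B4E.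
  move: B4E; rewrite -!mulmxA -!mulmxDr => {1}->.
  by eexists; rewrite -mulmxA.
split=> //; have [_ BXB _] := core_inverseP gB4.
by rewrite B3E mulmxA mulmxBl mul1mx BXB subrr mul0mx.
Qed.

Lemma core_inverse_block_col0 (C : numClosedFieldType) r s
    (U : 'M[C]_(r + s)) (B3 : 'M[C]_(s, r)) (B4 : 'M[C]_s) :
  U \is unitarymx -> group_mx (U *m block_mx 0 0 B3 B4 *m U^t*) ->
  core_inverse (U *m block_mx 0 0 B3 B4 *m U^t*) =
  U *m block_mx 0 0 0 (core_inverse B4) *m U^t*.
Proof.
move=> uU gB.
have [gB4 B3E] := group_block_col0 ((group_mx_unitary_conj _ uU).1 gB).
have [hX BXB [Z XZ]] := core_inverseP gB4.
apply: core_inverse_unique => //.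
- rewrite mul_unitary_conj // mulmx_block !(mul0mx, mulmx0, addr0, add0r).
  by rewrite adjmx_unitary_conj adjmx_block !adjmx0 hX.
- rewrite !mul_unitary_conj // !mulmx_block.
  rewrite !(mul0mx, mulmx0, addr0, add0r) BXB.
  (* The lower left block of [M X M = M] is [B4 B4^core B3 = B3]. *)
  by move: B3E; rewrite mulmxBl mul1mx => /subr0_eq <-.
exists (U *m block_mx 0 0 0 Z *m U^t*).
by rewrite mul_unitary_conj // mulmx_block !(mul0mx, mulmx0, addr0, add0r) -XZ.
Qed.

(** * The simultaneous decomposition *)

Lemma core_orthogonal_blocks (C : numClosedFieldType) r s
    (A B : 'M[C]_(r + s)) :
  \rank A = r -> group_mx A -> group_mx B -> A^t* *m B = 0 ->
  exists (U : 'M_(r + s)) (T : 'M_r) (S : 'M_(r, s)) (B3 : 'M_(s, r))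
         (B4 : 'M_s),
    [/\ U \is unitarymx /\ T \in unitmx,
        A = U *m block_mx T S 0 0 *m U^t*,
        B = U *m block_mx 0 0 B3 B4 *m U^t*,
        group_mx B4
      & (1%:M - B4 *m core_inverse B4) *m B3 = 0].
Proof.
move=> rA gA gB AB.
(* Rows for [A^t*] are columns for [A]: the first [r] columns of [U] span R(A), and the others are
   orthogonal to it. *)
have [||Q1 [Q2 [uW AQ2]]] := @unitary_completion C _ (r + s) r s (A^t*).
- by rewrite mxrank_map mxrank_tr.
- exact: addKn.
set W := col_mx Q1 Q2 in uW; pose U := W^t*.
have uU : U \is unitarymx by rewrite trmxC_unitary.
have conjK M : M = U *m (W *m M *m U) *m U^t*.
  rewrite trmxCK !mulmxA adjmx_unitaryK // mul1mx -mulmxA adjmx_unitaryK //.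
  by rewrite mulmx1.
have Q2A : Q2 *m A = 0.
  by rewrite -[LHS]trmxCK adjmx_mul AQ2 adjmx0.
have [T [S AE]] : exists (T : 'M_r) (S : 'M_(r, s)),
    W *m A *m U = block_mx T S 0 0.
  have -> : W *m A *m U = col_mx (Q1 *m A *m U) 0.
    by rewrite mul_col_mx Q2A mul_col_mx mul0mx.
  rewrite -[Q1 *m A *m U]hsubmxK -row_mx0 -/(block_mx _ _ _ _).
  by do 2!eexists.
have {}AE : A = U *m block_mx T S 0 0 *m U^t* by rewrite -AE -conjK.
have gTS : group_mx (block_mx T S 0 0 : 'M_(r + s)).
  by move: gA; rewrite {1}AE => /group_mx_unitary_conj; apply.
have Tu : T \in unitmx.
  apply: group_block_row0_unit gTS _; rewrite -[RHS]rA AE.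
  by rewrite mxrank_unitary_conj.
have [B1 [B2 [B3 [B4 BE]]]] : exists (B1 : 'M_r) (B2 : 'M_(r, s))
    (B3 : 'M_(s, r)) (B4 : 'M_s),
    B = U *m block_mx B1 B2 B3 B4 *m U^t*.
  by exists (ulsubmx (W *m B *m U)), (ursubmx (W *m B *m U)),
    (dlsubmx (W *m B *m U)), (drsubmx (W *m B *m U)); rewrite submxK.
(* In the new basis, orthogonality reads [T^t* B1 = 0] and [T^t* B2 = 0], and [T^t*] cancels. *)
have AB' : (block_mx T S 0 0 : 'M_(r + s))^t* *m block_mx B1 B2 B3 B4 = 0.
  move: AB; rewrite AE BE adjmx_unitary_conj mul_unitary_conj //.
  move=> /(congr1 (fun M => U^t* *m M *m U)).
  rewrite mulmx0 mul0mx !mulmxA adjmx_unitaryK // mul1mx -mulmxA.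
  by rewrite adjmx_unitaryK // mulmx1.
have Tadj : T^t* \in unitmx by rewrite map_unitmx unitmx_tr.
have [B1E B2E] : B1 = 0 /\ B2 = 0.
  move: AB'; rewrite adjmx_block mulmx_block !adjmx0 !mul0mx !addr0.
  rewrite -[0](@block_mx0 _ r s r s) => /eq_block_mx[TB1 TB2 _ _].
  by split; apply: (can_inj (mulKmx Tadj)); rewrite mulmx0.
rewrite {}B1E {}B2E in BE.
have [|gB4 B3E] := @group_block_col0 _ r s B3 B4.
  by move: gB; rewrite {1}BE => /group_mx_unitary_conj; apply.
by exists U, T, S, B3, B4.
Qed.

(** With [n], [r], [s] independent variables, [e] can be eliminated and the casts become identities;
    this fails when the sizes mention [\rank A]. *)
Lemma core_orthogonal_blocks_cast (C : numClosedFieldType) n r s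
    (e : (r + s)%N = n) (A B : 'M[C]_n) :
  \rank A = r -> group_mx A -> group_mx B ->
  (left_core_orthogonal A B <->
   exists (U : 'M_n) (T : 'M_r) (S : 'M_(r, s)) (B3 : 'M_(s, r))
          (B4 : 'M_s),
     [/\ U \is unitarymx /\ T \in unitmx,
         A = U *m castmx (e, e) (block_mx T S 0 0) *m U^t*,
         B = U *m castmx (e, e) (block_mx 0 0 B3 B4) *m U^t*,
         group_mx B4
       & (1%:M - B4 *m core_inverse B4) *m B3 = 0]) /\
  (forall (U : 'M_n) (B3 : 'M_(s, r)) (B4 : 'M_s), U \is unitarymx ->
     B = U *m castmx (e, e) (block_mx 0 0 B3 B4) *m U^t* ->
     core_inverse B =
       U *m castmx (e, e) (block_mx 0 0 0 (core_inverse B4)) *m U^t*).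
Proof.
case: n / e A B => A B rA gA gB; split; last first.
  move=> U B3 B4 uU; rewrite !castmx_id => BE.
  by rewrite BE core_inverse_block_col0 // -BE.
split=> [/(left_core_orthogonalP B gA) AB|].
  have [U [T [S [B3 [B4 dec]]]]] := core_orthogonal_blocks rA gA gB AB.
  by exists U, T, S, B3, B4; rewrite !castmx_id.
move=> [U [T [S [B3 [B4 [[uU _] AE BE _ _]]]]]].
apply/(left_core_orthogonalP B gA).
rewrite !castmx_id in AE BE.
rewrite AE BE adjmx_unitary_conj mul_unitary_conj // adjmx_block mulmx_block.
by rewrite !adjmx0 !(mul0mx, mulmx0, addr0) block_mx0 mulmx0 mul0mx.
Qed.

Theorem theorem3p6 (R : realType) (n : nat) (A B : 'M[R[i]]_n)
    (hA : group_mx A) (hB : group_mx B) :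
  (left_core_orthogonal A B <->
   exists (U : 'M[R[i]]_n) (T : 'M[R[i]]_(\rank A))
          (S : 'M[R[i]]_(\rank A, n - \rank A))
          (B3 : 'M[R[i]]_(n - \rank A, \rank A))
          (B4 : 'M[R[i]]_(n - \rank A)),
     core_orthogonal_decomposition A B U T S B3 B4) /\
  (forall (U : 'M[R[i]]_n) (T : 'M[R[i]]_(\rank A))
          (S : 'M[R[i]]_(\rank A, n - \rank A))
          (B3 : 'M[R[i]]_(n - \rank A, \rank A))
          (B4 : 'M[R[i]]_(n - \rank A)),
     core_orthogonal_decomposition A B U T S B3 B4 ->
     core_inverse B =
       U *m rank_block_mx A 0 0 0 (core_inverse B4) *m U ^t*).
Proof.
(* The equality proof is the one inside [rank_block_mx], so both casts agree by unfolding. *)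
have [iffAB coreB] := core_orthogonal_blocks_cast
  (subnKC (rank_leq_row A)) (erefl (\rank A)) hA hB.
split; first exact: iffAB.
by move=> U T S B3 B4 [[uU _] _ BE _ _]; apply: (coreB U B3 B4 uU BE).
Qed.
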